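(* Let $X$ be a real Banach space and let $X^*$ be its topological dual. Let $T:X\rightrightarrows X^*$ be a lower semicontinuous operator with convex domain $D(T)$. Let $D\subseteq D(T)$ be self segment-dense in $D(T)$ and assume that $T$ is locally strictly pseudomonotone on $D$. Assume further that for all $x,y\in D(T)$ with $x\neq y$, all $z\in[x,y]\cap(D(T)\setminus D)$ and all $z^*\in T(z)$ one has $\langle z^*,y-x\rangle\neq0$. Then $T$ is strictly pseudomonotone.
   Context: $\langle x^*,x\rangle = x^*(x)$ for $x^*\in X^*$, $x\in X$. For $x,y\in X$: $[x,y]=\{x+t(y-x):t\in[0,1]\}$. A set-valued operator $T:X\rightrightarrows X^*$ assigns to each $x\in X$ a (possibly empty) set $T(x)\subseteq X^*$; its domain is $D(T)=\{x:T(x)\ne\emptyset\}$ and its graph is $G(T)=\{(x,x^* ):x^*\in T(x)\}$. The restriction $T|_A$ agrees with $T$ on $A$ and is empty-valued elsewhere. $T$ is lower semicontinuous if for every $x\in D(T)$ and every (norm-)open $N\subseteq X^*$ with $T(x)\cap N\ne\emptyset$ there is a neighborhood $M$ of $x$ such that $T(y)\cap N\neq\emptyset$ for all $y\in M\cap D(T)$. $P\subseteq S$ is dense in $S$ if $S\subseteq \mathrm{cl}(P)$. For $U\subseteq V\subseteq X$ with $V$ convex, $U$ is self segment-dense in $V$ if $U$ is dense in $V$ and for all $x,y\in U$ the set $[x,y]\cap U$ is dense in $[x,y]$. $T$ is strictly pseudomonotone if for all $(x,x^* ),(y,y^* )\in G(T)$ with $x\neq y$: $\langle x^*,y-x\rangle\ge0\Rightarrow\langle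 y^*,y-x\rangle>0$. For $D\subseteq D(T)$, $T$ is locally strictly pseudomonotone on $D$ if every $x\in D$ has an open neighborhood $U_x$ such that $T|_{U_x\cap D}$ is strictly pseudomonotone. *)

(* Defs.v *)
From HB Require Import structures.
From mathcomp Require Import all_boot all_order all_algebra interval_inference.
From mathcomp Require Import all_classical all_reals.
From mathcomp Require Import topology convex normedtype.

Set Implicit Arguments.
Unset Strict Implicit.
Unset Printing Implicit Defensive.

Import Order.TTheory GRing.Theory Num.Theory.
Import numFieldNormedType.Exports.

Local Open Scope classical_set_scope.
Local Open Scope ring_scope.

Section Dual.
Context {R : realType} (X : normedModType R).

Definition is_dual : {pred X -> R^o} :=
  fun f => `[< linear f /\ continuous f >].

Lemma is_dualP (f : X -> R^o) : reflect (linear f /\ continuous f) (f \in is_dual).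
Proof. exact: asboolP. Qed.

Lemma is_dual_submod_closed : submod_closed is_dual.
Proof.
split; first by apply/is_dualP; split=> [a u v|x]; [rewrite /= scaler0 addr0|exact: cvg_cst].
move=> a f g /is_dualP[lf cf] /is_dualP[lg cg]; apply/is_dualP; split.
  move=> b u v; rewrite !fctE /= lf lg !scalerDr !scalerA (mulrC a b).
  by rewrite addrACA.
by move=> x; apply: cvgD; [apply: cvgZl_tmp; exact: cf|exact: cg].
Qed.

HB.instance Definition _ :=
  GRing.isSubmodClosed.Build R (X -> R^o) is_dual is_dual_submod_closed.

Record dual := Dual { dual_fun :> X -> R^o; _ : dual_fun \in is_dual }.

HB.instance Definition _ := [isSub of dual for dual_fun].
HB.instance Definition _ := [Choice of dual by <:].
HB.instance Definition _ := [SubChoice_isSubLmodule of dual by <:].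

Lemma dual_linear (f : dual) : linear f.
Proof. by case: f => f /= /is_dualP[]. Qed.

HB.instance Definition _ (f : dual) :=
  GRing.isLinear.Build R X R^o *:%R (dual_fun f) (dual_linear f).

Lemma dual_continuous (f : dual) : continuous f.
Proof. by case: f => f /= /is_dualP[]. Qed.

Lemma dual_inj (f g : dual) : (forall x, f x = g x) -> f = g.
Proof. by move=> fg; apply/val_inj/funext. Qed.

Definition dual_norm (f : dual) : R := sup [set `|f x| | x in [set x | `|x| <= 1]].

Lemma dual_norm_has_sup (f : dual) :
  has_sup [set `|f x| | x in [set x | `|x| <= 1]].
Proof.
split; first by exists `|f 0|, 0; rewrite //= normr0.
have := @continuous_linear_bounded R X R^o 0 f (@dual_continuous f 0).
by move=> /bounded_funP /(_ 1)[M fM]; exists M => _ [x /= x1 <-]; exact: fM.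
Qed.

Lemma dual_norm_ub (f : dual) x : `|x| <= 1 -> `|f x| <= dual_norm f.
Proof.
by move=> x1; apply: sup_upper_bound; [exact: dual_norm_has_sup|exists x].
Qed.

Lemma dual_norm_le (f : dual) M :
  (forall x, `|x| <= 1 -> `|f x| <= M) -> dual_norm f <= M.
Proof.
move=> fM; apply: ge_sup; first by case: (dual_norm_has_sup f).
by move=> _ [x /= x1 <-]; exact: fM.
Qed.

Lemma dual_norm_ge0 (f : dual) : 0 <= dual_norm f.
Proof. by apply: le_trans (@dual_norm_ub f 0 _) => //; rewrite normr0. Qed.

Lemma dual_normP (f : dual) x : `|f x| <= dual_norm f * `|x|.
Proof.
have [->|x0] := eqVneq x 0; first by rewrite linear0 !normr0 mulr0.
rewrite -ler_pdivrMr ?normr_gt0//.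
have -> : `|f x| / `|x| = `|f (`|x|^-1 *: x)|.
  by rewrite linearZ/= normrM normfV normr_id mulrC.
by apply: dual_norm_ub; rewrite normrZ normfV normr_id mulVf ?normr_eq0.
Qed.

Lemma dual_normD (f g : dual) : dual_norm (f + g) <= dual_norm f + dual_norm g.
Proof.
apply: dual_norm_le => x x1; apply: le_trans (ler_normD (f x) (g x)) _.
by rewrite lerD// dual_norm_ub.
Qed.

Lemma dual_normZ (a : R) (f : dual) : dual_norm (a *: f) = `|a| * dual_norm f.
Proof.
have le b (g : dual) : dual_norm (b *: g) <= `|b| * dual_norm g.
  apply: dual_norm_le => x x1; rewrite [X in X <= _](normrM b (g x)).
  by rewrite ler_wpM2l// dual_norm_ub.
apply/eqP; rewrite eq_le le/=.
have [->|a0] := eqVneq a 0; first by rewrite normr0 mul0r dual_norm_ge0.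
rewrite -ler_pdivlMl ?normr_gt0// -normfV.
by rewrite -{1}[f]scale1r -(mulVf a0) -scalerA le.
Qed.

Lemma dual_norm0_eq0 (f : dual) : dual_norm f = 0 -> f = 0.
Proof.
move=> f0; apply: dual_inj => x; apply/eqP; rewrite -normr_le0.
by rewrite (le_trans (dual_normP f x))// f0 mul0r.
Qed.

HB.instance Definition _ :=
  Lmodule_isNormed.Build R dual dual_normD dual_normZ dual_norm0_eq0.

End Dual.

Section Operators.
Context {R : realType} {X : normedModType R}.
Implicit Types (T : X -> set (dual X)) (A D P S U V : set X).

Definition segment (x y : X) : set X := [set x + t *: (y - x) | t in `[0, 1]].

Definition dom T : set X := [set x | T x !=set0].

Definition graph T : set (X * dual X) := [set p | T p.1 p.2].

Definition restriction T A : X -> set (dual X) := patch (fun=> set0) A T.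

Definition lower_semicontinuous_op T :=
  forall x, dom T x -> forall N : set (dual X), open N -> T x `&` N !=set0 ->
  exists2 M, nbhs x M & forall y, (M `&` dom T) y -> T y `&` N !=set0.

Definition dense_in P S := P `<=` S /\ S `<=` closure P.

(* The notion is only used for U `<=` V with V convex, so convexity of V is not
   repeated here. *)
Definition self_segment_dense U V :=
  dense_in U V /\
  forall x y, U x -> U y -> dense_in (segment x y `&` U) (segment x y).

Definition strictly_pseudomonotone T :=
  forall (x y : X) (xs ys : dual X), graph T (x, xs) -> graph T (y, ys) ->
  x != y -> 0 <= xs (y - x) -> 0 < ys (y - x).

(* Only used for D `<=` dom T. *)
Definition locally_strictly_pseudomonotone T D :=
  forall x, D x -> exists U : set X,
    [/\ open U, U x & strictly_pseudomonotone (restriction T (U `&` D))].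

End Operators.

(* Main.v *)
(* Let [v = y - x]. If some [z] in the open segment ]x, y[ lies outside [D], then
   a functional [zs] in [T z] cannot vanish at [w - z] for [w <> z] in [dom T];
   since [zs] takes opposite signs at [x - z] and [y - z], convexity confines
   [dom T] to the line through [x] and [y]. Hence, in all cases, [D] meets every
   open subsegment of [x, y], even when [x] and [y] are not in [D], and the
   statement reduces to one about the set-valued map
   [t |-> {zs v | zs in T (x + t v)}] on [0, 1], proved by a supremum argument. *)
Require Import Defs.
From mathcomp Require Import all_boot all_order all_algebra interval_inference.
From mathcomp Require Import all_classical all_reals.
From mathcomp Require Import topology convex normedtype.
From mathcomp Require Import ring lra.
Import Order.TTheory GRing.Theory Num.Theory.
Import numFieldNormedType.Exports.
Local Open Scope classical_set_scope.
Local Open Scope ring_scope.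

(* [I] plays the role of the parameters of points of [D]. The supremum is taken
   over the [t] such that [F] is positive on the points of [I] in ]0, t]; it can
   be pushed to the right because a nonnegative value of [F] is either attained
   in [I], or positive and then spreads to nearby points by semicontinuity. *)
Lemma lsc_sign_propagation (R : realType) (F : R -> set R) (I : set R) (a b : R) :
  (forall t, 0 <= t <= 1 -> F t !=set0) ->
  (forall t N, 0 <= t <= 1 -> open N -> F t `&` N !=set0 ->
     exists2 e, 0 < e & forall s, 0 <= s <= 1 -> `|s - t| < e -> F s `&` N !=set0) ->
  (forall c d, 0 <= c -> d <= 1 -> c < d -> exists2 r, c < r < d & I r) ->
  (forall t, 0 <= t <= 1 -> I t -> exists2 e, 0 < e & forall s r p q,
     0 <= s -> r <= 1 -> `|s - t| < e -> `|r - t| < e -> I s -> I r -> s < r ->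
     F s p -> F r q -> 0 <= p -> 0 < q) ->
  (forall t, 0 <= t <= 1 -> ~ I t -> ~ F t 0) ->
  F 0 a -> 0 <= a -> F 1 b -> 0 < b.
Proof.
move=> F0 Flsc Idense Iloc Fneq0 F0a a0 F1b.
(* Step to the right: a nonnegative value at [t] forces positivity on the points of [I] just after
   [t]. *)
have stepR t p : 0 <= t < 1 -> F t p -> 0 <= p ->
    exists2 e, 0 < e & forall r q, t < r -> r < t + e -> r <= 1 -> I r -> F r q -> 0 < q.
  move=> /andP[t0 t1] Ftp p0.
  have [It|nIt] := pselect (I t).
    have [||e e0 He] := Iloc t => //; first by rewrite t0 ltW.
    exists e => // r q tr rte r1 Ir Frq.
    by apply: (He t r p q) => //; [rewrite subrr normr0|rewrite ger0_norm; lra].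
  have pp : 0 < p.
    rewrite lt_neqAle p0 andbT; apply/eqP => p0'.
    by apply: (Fneq0 t) => //; [lra|rewrite p0'].
  have [||e e0 He] := Flsc t [set x | 0 < x] _ (@open_gt _ 0); first by lra.
    by exists p.
  exists e => // r q tr rte r1 Ir Frq.
  (* Since [t] is not in [I], [r] is compared with a point [s] of [I] in ]t, r[, close enough to [r]
     for the local hypothesis at [r]; semicontinuity at [t] supplies a positive value at [s]. *)
  have [||d d0 Hd] := Iloc r => //; first by lra.
  have [|||s /andP[ms sr] Is] := Idense (Num.max t (r - d)) r; rewrite ?le_max ?gt_max//.
  - by rewrite t0.
  - by rewrite tr/=; lra.
  move: ms; rewrite gt_max => /andP[ts ds].
  have [||k [/= Fsk k0]] := He s; first by lra.
    by rewrite ger0_norm; lra.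
  apply: (Hd s r k q) => //; try lra.
    by rewrite ler0_norm; lra.
  by rewrite subrr normr0.
(* Passage to the limit from the left: positivity on the points of [I] in ]0, t[ reaches [t]. If [t]
   is not in [I], zero is excluded and a negative value would spread to points of [I] before [t]. *)
have stepL t q : 0 < t <= 1 ->
    (forall r p, 0 < r < t -> I r -> F r p -> 0 < p) -> F t q -> 0 < q.
  move=> /andP[t0 t1] Pt Ftq.
  have [It|nIt] := pselect (I t).
    have [||e e0 He] := Iloc t => //; first by lra.
    have [|||s /andP[ms st] Is] := Idense (Num.max 0 (t - e)) t; rewrite ?le_max ?gt_max ?lexx//.
      by rewrite t0/=; lra.
    move: ms; rewrite gt_max => /andP[s0 es].
    have [|k Fsk] := F0 s; first by lra.
    apply: (He s t k q) => //; try lra.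
    - by rewrite ler0_norm; lra.
    - by rewrite subrr normr0.
    by apply/ltW/(Pt s) => //; lra.
  rewrite ltNge le_eqVlt; apply/negP => /orP[/eqP q0|q0].
    by apply: (Fneq0 t) => //; [lra|rewrite -q0].
  have [||e e0 He] := Flsc t [set x | x < 0] _ (@open_lt _ 0); first by lra.
    by exists q.
  have [|||s /andP[ms st] Is] := Idense (Num.max 0 (t - e)) t; rewrite ?le_max ?gt_max ?lexx//.
    by rewrite t0/=; lra.
  move: ms; rewrite gt_max => /andP[s0 es].
  have [||k [/= Fsk k0]] := He s; first by lra.
    by rewrite ler0_norm; lra.
  by have := Pt s k _ Is Fsk; lra.
pose A := [set t | 0 <= t <= 1 /\ forall r p, 0 < r <= t -> I r -> F r p -> 0 < p].
have A0 : A 0 by split=> [|r p]; lra.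
have supA : has_sup A by split; [exists 0|exists 1 => t [/andP[]]].
have s0 : 0 <= sup A by apply: sup_upper_bound.
have s1 : sup A <= 1 by apply: ge_sup; [exists 0|move=> t [/andP[]]].
have below r p : 0 < r < sup A -> I r -> F r p -> 0 < p.
  move=> /andP[r0 rs]; have [|t [_ At] rt] := @sup_adherent _ A (sup A - r) _ supA.
    lra.
  by apply: At; lra.
have [s1'|] := ltP (sup A) 1; last first.
  by move=> s1'; apply: (stepL 1) => // [|r p r1]; [lra|apply: below; lra].
(* The given value [a] serves if the supremum is 0; otherwise any value there is positive by
   [stepL]. *)
have [q Fq q0] : exists2 q, F (sup A) q & 0 <= q.
  have [s0'|s0'] := ltP 0 (sup A); last first.
    by exists a => //; have -> : sup A = 0 by lra.
  have [|q Fq] := F0 (sup A); first lra.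
  by exists q => //; apply/ltW/(stepL (sup A)) => //; lra.
have [|||e e0 He] := stepR (sup A) q => //; first lra.
(* This [t] exceeds [sup A] yet lies in [A], a contradiction; halving [e] keeps [t] strictly within
   the reach of [stepR]. *)
pose t := Num.min 1 (sup A + e / 2).
have t1 : t <= 1 by rewrite ge_min lexx.
have te : t <= sup A + e / 2 by rewrite ge_min lexx orbT.
have st : sup A < t by rewrite lt_min s1' /=; lra.
have : t <= sup A.
  apply: sup_upper_bound => //; split; first lra.
  move=> r p /andP[r0 rt] Ir Frp.
  have [rs|rs|rs] := ltgtP r (sup A).
  - by apply: (below r) => //; lra.
  - by apply: (He r) => //; lra.
  - by apply: (stepL r) => //; [lra|rewrite rs => r' p' h; apply: below].
lra.
Qed.

(** Follows from the operator norm bound; it turns open sets of reals into open sets of the dual, to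
    which lower semicontinuity of [T] applies. *)
Lemma eval_dual_continuous (R : realType) (X : normedModType R) (v : X) :
  continuous (fun f : dual X => f v : R).
Proof.
move=> f; have ff : Filter (nbhs f) := @nbhs_filter (dual X) f.
apply/(@cvgrPdist_lt _ _ _ _ ff) => e e0; apply/nbhs_ballP.
(* Adding 1 keeps the denominator positive when [v] is 0. *)
exists (e / (`|v| + 1)) => /=; first by rewrite divr_gt0// ltr_wpDl.
move=> g; rewrite -ball_normE /= => fg.
have -> : f v - g v = (f - g) v by [].
apply: (le_lt_trans (dual_normP (f - g) v)).
apply: (@le_lt_trans _ _ (dual_norm (f - g) * (`|v| + 1))).
  by rewrite ler_wpM2l ?dual_norm_ge0// lerDl.
by rewrite -ltr_pdivlMr ?ltr_wpDl.
Qed.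

Lemma convex_set_comb (R : realType) (X : normedModType R) (A : set X) (x y : X) (t : R) :
  convex_set (A : set (convex_lmodType X)) -> 0 <= t <= 1 -> A x -> A y ->
  A (x + t *: (y - x)).
Proof.
move=> cA /andP[t0 t1] Ax Ay.
have := cA y x (Itv01 t0 t1); rewrite !in_setE => /(_ Ay Ax).
suff -> : x + t *: (y - x) = conv (Itv01 t0 t1) (y : convex_lmodType X) x by [].
rewrite /conv/= /unstable.onem scalerBl scale1r scalerBr.
by rewrite addrCA.
Qed.

Lemma dual_comb (R : realType) (X : normedModType R) (f : dual X) (a b : R) (u w : X) :
  f (a *: u + b *: w) = a * f u + b * f w.
Proof. by rewrite linearD !linearZ. Qed.

(* If [f] is nonzero at [w - z], then [w] and whichever of [z - k v], [z + l v]
   lies on the other side of the hyperplane [f = f z] span a segment crossing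
   this hyperplane, necessarily at [z]. *)
Lemma convex_set_subset_line (R : realType) (X : normedModType R)
  (A : set X) (f : dual X) (z v w : X) (k l : R) :
  convex_set (A : set (convex_lmodType X)) ->
  (forall p, A p -> f (p - z) = 0 -> p = z) ->
  0 < k -> 0 < l -> v != 0 -> A (z - k *: v) -> A (z + l *: v) ->
  A w -> exists s : R, w = z + s *: v.
Proof.
move=> cA eqz k0 l0 v0 Ak Al Aw.
have fv0 : f v != 0.
  apply/eqP => fv0; have := eqz _ Al; rewrite addrAC subrr add0r linearZ/=.
  rewrite fv0 scaler0 => /(_ erefl)/eqP; rewrite -subr_eq0 addrAC subrr add0r scaler_eq0.
  by rewrite (negbTE v0) gt_eqF.
exists (f (w - z) / f v).
have comb m : A (z + m *: v) -> m * f v * f (w - z) < 0 ->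
    w = z + (f (w - z) / f v) *: v.
  move=> Ae neg.
  (* The parameter at which the segment from [z + m *: v] to [w] meets the hyperplane [f = f z]. *)
  pose lam := m * f v / (m * f v - f (w - z)).
  have d0 : m * f v - f (w - z) != 0 by apply/eqP; nra.
  have lam01 : 0 <= lam <= 1.
    have [d|d|d] := ltgtP (m * f v - f (w - z)) 0.
    - by rewrite /lam ler_ndivlMr ?ler_ndivrMr// mul0r mul1r; nra.
    - by rewrite /lam ler_pdivlMr ?ler_pdivrMr// mul0r mul1r; nra.
    - by rewrite d eqxx in d0.
  have lam0 : lam != 0.
    by rewrite mulf_neq0 ?invr_neq0//; apply: contraTneq neg => ->; rewrite mul0r ltxx.
  have := eqz _ (@convex_set_comb _ _ _ _ _ lam cA lam01 Ae Aw).
  have -> : z + m *: v + lam *: (w - (z + m *: v)) =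
            z + ((1 - lam) * m *: v + lam *: (w - z)).
    rewrite opprD (addrA w) (scalerBr lam (w - z)) scalerA mulrBl mul1r scalerBl.
    by rewrite -!addrA; congr (_ + (_ + _)); rewrite addrC.
  set p := ((1 - lam) * m) *: v + lam *: (w - z).
  have zp0 : f p = 0.
    have -> : f p = (1 - lam) * m * f v + lam * f (w - z).
      exact: dual_comb.
    by rewrite /lam; move: (f (w - z)) (f v) d0 => c g d0; field.
  rewrite addrAC subrr add0r => /(_ zp0)/eqP.
  rewrite -subr_eq0 addrAC subrr add0r /p.
  rewrite addr_eq0 => /eqP E; apply/eqP; rewrite addrC -subr_eq; apply/eqP.
  apply: (scalerI lam0); rewrite scalerA -[LHS]opprK -E -scaleNr; congr (_ *: _).
  rewrite /lam; move: (f (w - z)) (f v) d0 fv0 => c g d0 fv0; field.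
  by rewrite fv0.
have [n|n|/eqP] := ltgtP (f v * f (w - z)) 0.
- by apply: (comb l); rewrite // -mulrA pmulr_rlt0.
- by apply: (comb (- k)); rewrite ?scaleNr// -mulrA nmulr_rlt0 ?oppr_lt0.
- rewrite mulf_eq0 (negbTE fv0) => /eqP wz0.
  by rewrite wz0 mul0r scale0r addr0; apply: eqz.
Qed.

Theorem theorem3p6 (R : realType) (X : completeNormedModType R)
  (T : X -> set (dual X)) (D : set X)
  (T_lsc : lower_semicontinuous_op T)
  (domT_convex : convex_set (dom T : set (convex_lmodType X)))
  (D_sub : D `<=` dom T)
  (D_dense : self_segment_dense D (dom T))
  (T_lspm : locally_strictly_pseudomonotone T D)
  (T_neq0 : forall x y : X, dom T x -> dom T y -> x != y ->
     forall z : X, (segment x y `&` (dom T `\` D)) z ->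
     forall zs : dual X, T z zs -> zs (y - x) != 0) :
  strictly_pseudomonotone T.
Proof.
move=> x y xs ys Tx Ty xNy xs_ge0.
set v := y - x in xs_ge0 *.
have v0 : v != 0 by rewrite subr_eq0 eq_sym.
pose line t := x + t *: v.
have line0 : line 0 = x by rewrite /line scale0r addr0.
have line1 : line 1 = y by rewrite /line scale1r addrC subrK.
have lineB s t : line s - line t = (s - t) *: v.
  by rewrite /line opprD addrACA subrr add0r scalerBl.
have domx : dom T x by exists xs.
have domy : dom T y by exists ys.
have dom_line t : 0 <= t <= 1 -> dom T (line t).
  by move=> t01; apply: convex_set_comb.
have line_nbhs t M : nbhs (line t) M ->
    exists2 e, 0 < e & forall s, `|s - t| < e -> M (line s).
  move=> /nbhs_ballP[e /= e0 eM]; exists (e / `|v|); first by rewrite divr_gt0 ?normr_gt0.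
  move=> s; rewrite ltr_pdivlMr ?normr_gt0// => st; apply: eM.
  by rewrite -ball_normE/= lineB normrZ distrC.
apply: (@lsc_sign_propagation R (fun t => [set zs v | zs in T (line t)])
  [set t | D (line t)] (xs v) (ys v)).
- by move=> t /dom_line[zs Tz]; exists (zs v), zs.
- move=> t N t01 oN [_ [[zs Tz <-] Nz]].
  have [||M Mt MN] := T_lsc _ (dom_line _ t01) ((fun f : dual X => f v : R) @^-1` N).
  + by apply: open_comp => // f _; exact: eval_dual_continuous.
  + by exists zs.
  have [e e0 eM] := line_nbhs _ _ Mt.
  exists e => // s s01 st.
  have [|fs [Tfs Nfs]] := MN (line s); first by split; [exact: eM|exact: dom_line].
  by exists (fs v); split=> //; exists fs.
(* If the midpoint is not in [D], the domain lies on the line, so a point of [D] near the midpoint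
   has a parameter in ]c, d[. *)
- move=> c d c0 d1 cd; pose m := (c + d) / 2.
  have [Im|nIm] := pselect (D (line m)); first by exists m => //; rewrite /m; lra.
  have m01 : 0 < m < 1 by rewrite /m; lra.
  have [|zs Tz] := dom_line m; first lra.
  have domT_line w : dom T w -> exists s, w = line m + s *: v.
    apply: (@convex_set_subset_line _ _ (dom T) zs (line m) v w m (1 - m)) => //; try lra.
    - move=> p Dp zp; apply/esym/eqP/contraT => zNp.
      (* The nonvanishing hypothesis is applied to the segment from [line m] to [p], at its first
         endpoint. *)
      have zz : (segment (line m) p `&` (dom T `\` D)) (line m).
        split; last by split=> //; exists zs.
        by exists 0; rewrite ?scale0r ?addr0//= in_itv/= lexx ler01.
      by have := T_neq0 _ p (ex_intro _ zs Tz) Dp zNp _ zz zs Tz; rewrite zp eqxx.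
    - by rewrite /line addrK.
    - by rewrite /line -addrA -scalerDl subrKC scale1r addrC subrK.
  have dv : 0 < (d - c) / 2 * `|v| by rewrite mulr_gt0 ?normr_gt0//; lra.
  have [w [Dw mw]] : D `&` ball (line m) ((d - c) / 2 * `|v|) !=set0.
    by apply: D_dense.1.2; [exists zs|exact: nbhsx_ballx].
  have [s ws] := domT_line _ (D_sub _ Dw).
  move: mw; rewrite -ball_normE/= ws opprD addrA subrr add0r normrN normrZ.
  rewrite ltr_pM2r ?normr_gt0// ltr_norml => /andP[s1 s2].
  exists (m + s); first by rewrite /m; lra.
  by rewrite /= /line scalerDl addrA -/(line m) -ws.
- move=> t t01 Dt; have [U [oU Ut spm]] := T_lspm _ Dt.
  have [e e0 eU] := line_nbhs t U (open_nbhs_nbhs (conj oU Ut)).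
  exists e => // s r _ _ s0 r1 st rt Ds Dr sr [f Tf <-] [g Tg <-] f0.
  have := spm (line s) (line r) f g.
  rewrite /graph /restriction /= !patchT ?inE; [|by split=> //; exact: eU..].
  (* The difference of the two points is [(r - s) *: v] with [r - s] positive, so signs can be read
     at [v]. *)
  rewrite lineB linearZ [g _]linearZ/= => /(_ Tf Tg).
  have sr0 : 0 < r - s by rewrite subr_gt0.
  rewrite pmulr_rge0// pmulr_rgt0//; apply => //.
  by rewrite -subr_eq0 -opprB lineB oppr_eq0 scaler_eq0 (negbTE v0) gt_eqF.
- move=> t t01 nDt [zs Tz zv0].
  have := T_neq0 x y domx domy xNy (line t) _ zs Tz; rewrite zv0 eqxx => H.
  apply: notF; apply: H; split; last by split=> //; exact: dom_line.
  by exists t; rewrite //= in_itv.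
- by exists xs; rewrite // line0.
- by [].
- by exists ys; rewrite // line1.
Qed.
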